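(* Let $A$ be an $n\times n$ irreducible stochastic matrix whose digraph is periodic of period $t\ge2$ with periodic partition $\{P_1,\ldots,P_t\}$. Then every solution $X\in\mathrm{Sym}(\mathcal V)$ of $AXA^*=X$ is a linear combination $\sum_{\delta\ge0}c_\delta X^{(\delta)}$ with nonnegative coefficients $c_\delta$.
   Context: $\mathcal V=\mathbb R^n$ and $\mathrm{Sym}(\mathcal V)$ is the cone of $n\times n$ real symmetric matrices with nonnegative entries; $A^*$ is the transpose. The digraph of $A$ has vertices $\{1,\ldots,n\}$ and an edge $i\to j$ iff $A_{ij}>0$; it is periodic of period $t\ge2$ with periodic partition $\{P_1,\ldots,P_t\}$ if every edge from $P_k$ ends in $P_{k+1}$ (indices mod $t$) and $t$ is the largest integer for which such a partition exists. For $i\in P_{s_1}$, $j\in P_{s_2}$, $\operatorname{dist}(i,j)=\min\{|s_1-s_2|,\ t-|s_1-s_2|\}$. For $\delta\ge0$, $X^{(\delta)}$ is the 0-1 matrix with $X^{(\delta)}_{ij}=1$ iff $\operatorname{dist}(i,j)=\delta$; the sum runs over the attained values $0\le\delta\le\lfloor t/2\rfloor$. *)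

(* Defs.v *)
From mathcomp Require Import all_boot all_order all_algebra.
From mathcomp Require Import reals.

Set Implicit Arguments.
Unset Strict Implicit.
Unset Printing Implicit Defensive.

Import Order.TTheory GRing.Theory Num.Theory.
Local Open Scope ring_scope.

Definition stochastic (R : realType) (n : nat) (A : 'M[R]_n) : Prop :=
  (forall i j, 0 <= A i j) /\ (forall i, \sum_j A i j = 1).

Definition digraph (R : realType) (n : nat) (A : 'M[R]_n) : rel 'I_n :=
  fun i j => 0 < A i j.

Definition irreducible_mx (R : realType) (n : nat) (A : 'M[R]_n) : Prop :=
  forall i j, connect (digraph A) i j.

(* The parts are indexed by 0, ..., t-1, and ordS is the successor modulo t.
   Injectivity of P makes the t parts distinct; nonemptiness of the parts is
   contained in partition. *)
Definition cyclic_partition (R : realType) (n t : nat) (A : 'M[R]_n)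
    (P : 'I_t -> {set 'I_n}) : Prop :=
  [/\ injective P,
      partition [set P k | k : 'I_t] [set: 'I_n]
    & forall (k : 'I_t) (i j : 'I_n),
        i \in P k -> digraph A i j -> j \in P (ordS k)].

Definition periodic (R : realType) (n t : nat) (A : 'M[R]_n)
    (P : 'I_t -> {set 'I_n}) : Prop :=
  [/\ (2 <= t)%N,
      cyclic_partition A P
    & forall (t' : nat) (P' : 'I_t' -> {set 'I_n}),
        cyclic_partition A P' -> (t' <= t)%N].

Definition nonneg_symmetric (R : realType) (n : nat) (X : 'M[R]_n) : Prop :=
  X^T = X /\ forall i j, 0 <= X i j.

Definition cyclic_dist (t : nat) (s1 s2 : 'I_t) : nat :=
  minn `|s1 - s2|%N (t - `|s1 - s2|%N)%N.

(* When P is a partition, s1 and s2 are the unique indices of the parts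
   containing i and j. *)
Definition dist_mx (R : realType) (n t : nat) (P : 'I_t -> {set 'I_n})
    (delta : nat) : 'M[R]_n :=
  \matrix_(i, j) [exists s1 : 'I_t, exists s2 : 'I_t,
    [&& i \in P s1, j \in P s2 & cyclic_dist s1 s2 == delta]]%:R.
Arguments dist_mx R {n t} P delta.

(* Main.v *)
(** A solution of [A X A^T = X] is harmonic for the chain moving two
    coordinates independently by [A]. Since [t] is the gcd of the return times,
    some power of [A] is positive between any two vertices of the same part, so
    the maximum principle makes [X] constant on each block [P_r x P_s]. Applying
    harmonicity again, the block value is invariant under simultaneous shifts of
    [r] and [s]; with symmetry it depends only on their cyclic distance. *)
Require Import Defs.
From mathcomp Require Import all_boot all_order all_algebra.
From mathcomp Require Import reals boolp zify.

Set Implicit Arguments.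
Unset Strict Implicit.
Unset Printing Implicit Defensive.

Import Order.TTheory GRing.Theory Num.Theory.
Local Open Scope ring_scope.

(** * Cyclic partitions as class functions *)

Section CyclicPartition.
Variables (R : realType) (n t : nat) (A : 'M[R]_n).

(** Parts that meet coincide, and injectivity of [P] then identifies their indices. *)
Lemma cyclic_partition_classes (P : 'I_t -> {set 'I_n}) :
  cyclic_partition A P ->
  exists f : 'I_n -> 'I_t,
    [/\ forall i s, (i \in P s) = (s == f i),
        forall s, exists i, f i = s
      & forall i j, 0 < A i j -> f j = ordS (f i)].
Proof.
move=> [Pinj Ppart Pedge].
have [/eqP Pcov Ptriv P0] := and3P Ppart.
have inP i : exists s, i \in P s.
  have : i \in cover [set P k | k : 'I_t] by rewrite Pcov inE.
  by case/bigcupP => B /imsetP[s _ ->] iPs; exists s.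
have uniqP i s s' : i \in P s -> i \in P s' -> s = s'.
  move=> iPs iPs'; apply: Pinj.
  rewrite -(def_pblock Ptriv (imset_f _ _) iPs) //.
  by rewrite -(def_pblock Ptriv (imset_f _ _) iPs').
have [f fP] := fin_all_exists inP.
exists f; split.
- by move=> i s; apply/idP/eqP => [iPs|-> //]; apply: uniqP iPs (fP i).
- move=> s; have /set0Pn[i iPs] : P s != set0.
    by apply: contraNneq P0 => <-; apply: imset_f.
  by exists i; apply: uniqP iPs.
- by move=> i j Aij; apply: (uniqP j); [exact: fP | apply: (Pedge _ i)].
Qed.

(** The converse passage: it makes a partition out of residues of walk lengths, so that maximality
    of the period can be applied to it. *)
Lemma classes_cyclic_partition (f : 'I_n -> 'I_t) :
    (forall s, exists i, f i = s) ->
    (forall i j, 0 < A i j -> f j = ordS (f i)) ->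
  cyclic_partition A (fun s => [set i | f i == s]).
Proof.
move=> fsurj fedge; split.
- move=> s s' /setP eq_ss'; have [i fi] := fsurj s.
  by have := eq_ss' i; rewrite !inE fi eqxx => /esym/eqP.
- apply/and3P; split.
  + apply/eqP/setP => i; rewrite inE; apply/bigcupP.
    by exists [set j | f j == f i]; rewrite ?imset_f // inE.
  + apply/trivIsetP => _ _ /imsetP[s _ ->] /imsetP[s' _ ->] neq.
    rewrite -setI_eq0; apply/eqP/setP => i; rewrite !inE.
    apply/negP => /andP[/eqP is_s /eqP is_s'].
    by case/eqP: neq; rewrite -is_s -is_s'.
  + apply/imsetP => -[s _ /setP/= eq0]; have [i fi] := fsurj s.
    by have := eq0 i; rewrite !inE fi eqxx.
- by move=> k i j; rewrite !inE => /eqP <- /fedge ->.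
Qed.

End CyclicPartition.

(** * Positive entries of powers of [A], that is, walks in the digraph *)

Section MatrixPowers.
Variables (R : realType) (n : nat) (A : 'M[R]_n).
Hypothesis Astoch : stochastic A.

Lemma expmx_ge0 m i j : 0 <= (A ^+ m) i j.
Proof.
have [A0 _] := Astoch; elim: m i j => [|m IH] i j.
  by rewrite expr0 mxE; case: eqP.
by rewrite exprS mxE; apply: sumr_ge0 => k _; apply: mulr_ge0.
Qed.

Lemma expmx_row_sum m i : \sum_j (A ^+ m) i j = 1.
Proof.
have [_ A1] := Astoch; elim: m i => [|m IH] i.
  rewrite expr0 (bigD1 i) //= mxE eqxx big1 ?addr0 // => j.
  by rewrite mxE eq_sym => /negPf ->.
under eq_bigr do rewrite exprS mxE.
rewrite exchange_big /= -(A1 i); apply: eq_bigr => k _.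
by rewrite -mulr_sumr IH mulr1.
Qed.

Lemma expmx0_gt0 i : 0 < (A ^+ 0) i i.
Proof. by rewrite expr0 mxE eqxx. Qed.

Lemma expmxD_gt0 m p i j k :
  0 < (A ^+ m) i j -> 0 < (A ^+ p) j k -> 0 < (A ^+ (m + p)) i k.
Proof.
move=> ij jk; rewrite exprD mxE (bigD1 j) //=.
rewrite ltr_pwDl ?mulr_gt0 //.
by apply: sumr_ge0 => l _; rewrite mulr_ge0 ?expmx_ge0.
Qed.

Lemma expmxM_gt0 m p i : 0 < (A ^+ m) i i -> 0 < (A ^+ (p * m)) i i.
Proof.
move=> ii; elim: p => [|p IH]; first by rewrite mul0n expmx0_gt0.
by rewrite mulSn; apply: expmxD_gt0 IH.
Qed.

Lemma expmxS_gt0 m i k : 0 < (A ^+ m.+1) i k ->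
  exists2 j, 0 < (A ^+ m) i j & 0 < A j k.
Proof.
have [A0 _] := Astoch; rewrite exprSr mxE => ik.
have /existsP[j /andP[]] : [exists j, (0 < (A ^+ m) i j) && (0 < A j k)].
  apply: contraLR ik => /existsPn no; rewrite -leNgt big1 // => j _.
  have := no j; rewrite !lt0r expmx_ge0 A0 !andbT.
  by rewrite negb_and !negbK => /orP[]/eqP ->; rewrite ?mul0r ?mulr0.
by exists j.
Qed.

Lemma expmx_succ m i : exists j, 0 < (A ^+ m) i j.
Proof.
apply/existsP; apply: contraTT (ltr01 : 0 < 1 :> R) => /existsPn no.
rewrite -(expmx_row_sum m i) -leNgt; apply: sumr_le0 => j _.
by rewrite leNgt.
Qed.

Lemma connect_expmx_gt0 i j :
  connect (digraph A) i j -> exists m, 0 < (A ^+ m) i j.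
Proof.
case/connectP => p; elim: p i => [|k p IH] i /=.
  by move=> _ ->; exists 0%N; apply: expmx0_gt0.
case/andP => Aik /IH{}IH /IH[m kj]; exists (1 + m)%N.
by apply: expmxD_gt0 kj; rewrite expr1.
Qed.

(** Each step of a walk advances the class by one modulo [t]. *)
Lemma expmx_gt0_class t (f : 'I_n -> 'I_t) :
    (forall i j, 0 < A i j -> f j = ordS (f i)) ->
  forall m i j, 0 < (A ^+ m) i j -> f j = f i + m %[mod t].
Proof.
move=> fedge; elim=> [|m IH] i k.
  by rewrite expr0 mxE addn0; case: eqP => [->|_]; rewrite ?ltxx.
move=> /expmxS_gt0[j /IH ij /fedge ->] /=.
by rewrite modn_mod -addn1 -modnDml ij modnDml addn1 addnS.
Qed.

(** * Return times to a vertex *)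

Section Return.
Variable v : 'I_n.
Hypothesis Airr : irreducible_mx A.

(* A minimal positive difference of return times divides every return time;
   classes modulo it then form a cyclic partition. *)
Lemma return_time_cyclic_partition : exists g q : nat,
  [/\ (0 < g)%N, 0 < (A ^+ q) v v, 0 < (A ^+ (q + g)) v v
    & exists P : 'I_g -> {set 'I_n}, cyclic_partition A P].
Proof.
pose Q g := `[< (0 < g)%N /\
  exists q, 0 < (A ^+ q) v v /\ 0 < (A ^+ (q + g)) v v >].
(* A step out of [v] and a walk back form a positive return time, compared with the return time
   0. *)
have exQ : exists g, Q g.
  have [j vj] := expmx_succ 1 v; have [m jv] := connect_expmx_gt0 (Airr j v).
  exists (1 + m)%N; apply/asboolP; split=> //; exists 0%N.
  by split; [exact: expmx0_gt0 | exact: expmxD_gt0 vj jv].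
case: (ex_minnP exQ) => g /asboolP[g0 [q [vq vqg]]] gmin.
exists g, q; split=> //.
have gdvd m : 0 < (A ^+ m) v v -> (g %| m)%N.
  move=> vm; rewrite /dvdn -leqn0 leqNgt; apply/negP => r0.
  have : Q (m %% g)%N.
    (* The return times [m %/ g * (q + g)] and [m %/ g * q + m] differ by [m %% g], which is below
       the minimum [g]. *)
    apply/asboolP; split=> //; exists (m %/ g * (q + g))%N.
    split; first exact: expmxM_gt0.
    rewrite mulnDr -addnA -divn_eq.
    by apply: expmxD_gt0 vm; apply: expmxM_gt0.
  by move/gmin; rewrite leqNgt ltn_pmod.
have [w vw] := fin_all_exists (fun i => connect_expmx_gt0 (Airr v i)).
(* Two walks from [v] to [i], closed by the same walk back, both get lengths divisible by [g]. *)
have wmod m i : 0 < (A ^+ m) v i -> m = w i %[mod g].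
  move=> vi; have [p iv] := connect_expmx_gt0 (Airr i v).
  apply/eqP; rewrite -(eqn_modDr p).
  have /gdvd/eqP -> := expmxD_gt0 vi iv.
  by have /gdvd/eqP -> := expmxD_gt0 (vw i) iv.
pose f i : 'I_g := Ordinal (ltn_pmod (w i) g0).
exists (fun s => [set i | f i == s]); apply: classes_cyclic_partition.
  move=> s; have [i vi] := expmx_succ s v; exists i; apply: val_inj => /=.
  by rewrite -(wmod _ _ vi) modn_small.
move=> i j ij; apply: val_inj => /=; rewrite -addn1 modnDml addn1.
rewrite -(wmod (w i).+1) // -addn1.
by apply: expmxD_gt0 (vw i) _; rewrite expr1.
Qed.

End Return.

(** * Positivity between vertices of the same class *)

Section Periodic.
Variables (t : nat) (f : 'I_n -> 'I_t).
Hypothesis Airr : irreducible_mx A.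
Hypothesis fedge : forall i j, 0 < A i j -> f j = ordS (f i).
Hypothesis tmax : forall g (P : 'I_g -> {set 'I_n}),
  cyclic_partition A P -> (g <= t)%N.

(** Return times are multiples of [t], so [t] divides the difference [g], while maximality gives
    [g <= t]. Hence two consecutive multiples of [t] are return times, and their sums reach every
    large multiple. *)
Lemma return_times v : exists N, forall M, (N <= M)%N ->
  0 < (A ^+ (M * t)) v v.
Proof.
have [g [q [g0 vq vqg [P /tmax gt]]]] := return_time_cyclic_partition v Airr.
have dvd m : 0 < (A ^+ m) v v -> (t %| m)%N.
  move/(expmx_gt0_class fedge)/eqP.
  by rewrite -{1}[val (f v)]addn0 eqn_modDl mod0n eq_sym.
have gE : g = t.
  apply/eqP; rewrite eqn_leq gt dvdn_leq //.
  by rewrite -(dvdn_addr _ (dvd _ vq)) dvd.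
have [r qE] := dvdnP (dvd _ vq); move: vq vqg; rewrite {}gE {}qE => vq vqg.
have vr : 0 < (A ^+ (r.+1 * t)) v v by rewrite mulSn addnC.
exists (r * r)%N => M leM; case: (posnP r) => [r0|r0].
  by apply: expmxM_gt0; rewrite r0 mul1n in vr.
(* M = r x + y with y < r <= x, hence M = (x - y) r + y (r + 1). *)
have yr := ltn_pmod M r0.
have rx : (r <= M %/ r)%N by rewrite leq_divRL.
have -> : (M * t = (M %/ r - M %% r) * (r * t) + M %% r * (r.+1 * t))%N.
  rewrite {1}(divn_eq M r); nia.
by apply: expmxD_gt0; apply: expmxM_gt0.
Qed.

(** Loop at [i] for a large multiple of [t], then follow a fixed walk to [k]; its length is a
    multiple of [t] because the classes agree. Finitely many pairs allow a common [N]. *)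
Lemma expmx_block_gt0 : exists N, forall i k, f i = f k ->
  0 < (A ^+ (N * t)) i k.
Proof.
have ex (ik : 'I_n * 'I_n) : exists N, forall M, (N <= M)%N ->
    f ik.1 = f ik.2 -> 0 < (A ^+ (M * t)) ik.1 ik.2.
  case: ik => i k /=; have [N vN] := return_times i.
  have [m ik] := connect_expmx_gt0 (Airr i k).
  exists (N + m)%N => M leM fik.
  have /dvdnP[r mE] : (t %| m)%N.
    have /eqP := expmx_gt0_class fedge ik.
    by rewrite -fik -{1}[val (f i)]addn0 eqn_modDl mod0n eq_sym.
  have t0 : (0 < t)%N by case: (f i) => s; case: (t).
  have -> : (M * t = (M - r) * t + m)%N by subst m; nia.
  by apply: expmxD_gt0 ik; apply: vN; nia.
have [N NP] := fin_all_exists ex.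
exists (\max_ik N ik) => i k fik.
by apply: (NP (i, k)) => //; apply: leq_bigmax.
Qed.

(** * Solutions of the fixed-point equation *)

Variable X : 'M[R]_n.
Hypothesis XA : A *m X *m A^T = X.

Lemma fixed_expmx m i j :
  X i j = \sum_k \sum_l (A ^+ m) i k * (A ^+ m) j l * X k l.
Proof.
have XAm : A ^+ m *m X *m (A ^+ m)^T = X.
  elim: m => [|m IH]; first by rewrite expr0 trmx1 mul1mx mulmx1.
  by rewrite exprS trmx_mul !mulmxA -[A *m _ *m X]mulmxA -(mulmxA A) IH.
rewrite -{1}XAm mxE exchange_big /=; apply: eq_bigr => l _.
rewrite !mxE mulr_suml; apply: eq_bigr => k _.
by rewrite mulrAC.
Qed.

Lemma expmx_weight_sum m i j : \sum_k \sum_l (A ^+ m) i k * (A ^+ m) j l = 1.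
Proof.
under eq_bigr do rewrite -mulr_sumr expmx_row_sum mulr1.
exact: expmx_row_sum.
Qed.

(* The maximum principle, applied at an entry maximal in its block. *)
Lemma fixed_block_const i j k l : f i = f k -> f j = f l -> X i j = X k l.
Proof.
have [N AN] := expmx_block_gt0.
pose B (p : 'I_n * 'I_n) := (f p.1 == f i) && (f p.2 == f j).
have Bij : B (i, j) by rewrite /B !eqxx.
case: (arg_maxP (fun p => X p.1 p.2) Bij) => -[a b] /andP[/= /eqP fa /eqP fb].
move=> Xmax.
suff Xab c d : f c = f i -> f d = f j -> X c d = X a b.
  by move=> fik fjl; rewrite !Xab.
move=> fc fd; have classN p q : 0 < (A ^+ (N * t)) p q -> f q = f p.
  move/(expmx_gt0_class fedge); rewrite -modnDmr modnMl addn0 !modn_small //.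
  exact: val_inj.
pose w p := (A ^+ (N * t)) a p.1 * (A ^+ (N * t)) b p.2.
(* Where the weight is nonzero, [p] lies in the block on which [X a b] is maximal. *)
have wX0 p : 0 <= w p * (X a b - X p.1 p.2).
  have := expmx_ge0 (N * t) a p.1; rewrite /w le0r => /predU1P[->|ap].
    by rewrite !mul0r.
  have := expmx_ge0 (N * t) b p.2; rewrite le0r => /predU1P[->|bp].
    by rewrite mulr0 mul0r.
  rewrite !mulr_ge0 ?expmx_ge0 // subr_ge0; apply: Xmax.
  by rewrite /B (classN _ _ ap) (classN _ _ bp) fa fb !eqxx.
have sum0 : \sum_p w p * (X a b - X p.1 p.2) = 0.
  under eq_bigr do rewrite mulrBr.
  rewrite sumrB -mulr_suml.
  rewrite -(pair_bigA _ (fun p q => (A ^+ (N * t)) a p * (A ^+ (N * t)) b q)).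
  rewrite -(pair_bigA _
    (fun p q => (A ^+ (N * t)) a p * (A ^+ (N * t)) b q * X p q)) /=.
  by rewrite expmx_weight_sum mul1r -fixed_expmx subrr.
(* A vanishing sum of nonnegative terms has zero terms, and the weight at [(c, d)] is positive. *)
have /eqP := psumr_eq0P (fun p _ => wX0 p) sum0 (i := (c, d)) isT.
rewrite mulf_eq0 subr_eq0 /w /= => /orP[|/eqP //].
by rewrite gt_eqF // mulr_gt0 // AN ?fa ?fb.
Qed.

(** [X i j] averages [X] over the pairs reached in [m] steps, all of which lie in the block of
    [(k, l)], where [X] is constant. *)
Lemma fixed_shift m i j k l :
  f k = f i + m %[mod t] -> f l = f j + m %[mod t] -> X i j = X k l.
Proof.
have modf x y : f x = f y %[mod t] -> f x = f y.
  by rewrite !modn_small // => /val_inj.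
move=> fk fl; rewrite (fixed_expmx m) -[RHS]mul1r -(expmx_weight_sum m i j).
rewrite mulr_suml; apply: eq_bigr => p _.
rewrite mulr_suml; apply: eq_bigr => q _.
have := expmx_ge0 m i p; rewrite le0r => /predU1P[->|ip]; first by rewrite !mul0r.
have := expmx_ge0 m j q; rewrite le0r => /predU1P[->|jq].
  by rewrite mulr0 !mul0r.
congr (_ * _); apply: fixed_block_const; apply: modf.
  by rewrite fk (expmx_gt0_class fedge ip).
by rewrite fl (expmx_gt0_class fedge jq).
Qed.

End Periodic.
End MatrixPowers.

(** * Cyclic distance and the coefficients *)

Lemma cyclic_distC t (s1 s2 : 'I_t) : cyclic_dist s1 s2 = cyclic_dist s2 s1.
Proof. by rewrite /cyclic_dist distnC. Qed.

Lemma cyclic_dist_le t (s1 s2 : 'I_t) : (cyclic_dist s1 s2 <= t./2)%N.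
Proof. by rewrite /cyclic_dist; lia. Qed.

(** The start of the shorter arc is rotated to 0, so its other end lands on the distance. Which
    index is the start varies; symmetry of [X] will absorb this. *)
Lemma cyclic_dist_shift t (s1 s2 : 'I_t) : (s1 <= s2)%N -> exists m,
  ((s1 + m) %% t = 0 /\ (s2 + m) %% t = cyclic_dist s1 s2 %% t)%N \/
  ((s2 + m) %% t = 0 /\ (s1 + m) %% t = cyclic_dist s1 s2 %% t)%N.
Proof.
move=> le12; have [lt1 lt2] := (ltn_ord s1, ltn_ord s2).
have -> : cyclic_dist s1 s2 = minn (s2 - s1) (t - (s2 - s1)).
  by rewrite /cyclic_dist distnEr.
case: (leqP (s2 - s1) (t - (s2 - s1))) => _.
  exists (t - s1)%N; left; rewrite subnKC ?(ltnW lt1) // modnn; split=> //.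
  by rewrite -(modnDr (s2 - s1) t); congr (_ %% _)%N; lia.
exists (t - s2)%N; right; rewrite subnKC ?(ltnW lt2) // modnn; split=> //.
by congr (_ %% _)%N; lia.
Qed.

Theorem mainTheorem10 (R : realType) (n t : nat) (A : 'M[R]_n)
    (P : 'I_t -> {set 'I_n}) :
  irreducible_mx A -> stochastic A -> periodic A P ->
  forall X : 'M[R]_n, nonneg_symmetric X -> A *m X *m A^T = X ->
  exists c : 'I_(t./2).+1 -> R,
    (forall delta, 0 <= c delta) /\
    X = \sum_(delta < (t./2).+1) c delta *: dist_mx R P delta.
Proof.
move=> Airr Astoch [t2 Pcyc tmax] X [Xsym X0] XA.
have [f [fP fsurj fedge]] := cyclic_partition_classes Pcyc.
have t0 : (0 < t)%N by lia.
have [rep repP] := fin_all_exists fsurj.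
pose e d : 'I_t := Ordinal (ltn_pmod d t0).
(* The coefficient of [d] is the value of [X] on the block of classes 0 and [d]. *)
exists (fun d => X (rep (e 0%N)) (rep (e d))); split; first by move=> d; apply: X0.
have shift := fixed_shift Astoch Airr fedge tmax XA.
have Xd i j : X i j = X (rep (e 0%N)) (rep (e (cyclic_dist (f i) (f j)))).
  wlog le_ij : i j / (f i <= f j)%N.
    move=> W; case: (leqP (f i) (f j)) => [|/ltnW] /W // Xji.
    by rewrite cyclic_distC -Xji -[in LHS]Xsym mxE.
  have [m [[m0 md]|[m0 md]]] := cyclic_dist_shift le_ij.
    by apply: (shift m); rewrite repP /= modn_mod ?m0 ?md ?mod0n.
  rewrite -[in LHS]Xsym mxE.
  by apply: (shift m); rewrite repP /= modn_mod ?m0 ?md ?mod0n.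
apply/matrixP => i j; rewrite Xd summxE.
pose d := Ordinal (cyclic_dist_le (f i) (f j) : _ < (t./2).+1)%N.
have distE (k : nat) : dist_mx R P k i j = (cyclic_dist (f i) (f j) == k)%:R.
  rewrite mxE; congr (nat_of_bool _)%:R; apply/existsP/idP.
    by case=> s1 /existsP[s2]; rewrite !fP => /and3P[/eqP-> /eqP->].
  by move=> dk; exists (f i); apply/existsP; exists (f j); rewrite !fP !eqxx.
(* At entry [(i, j)] only the summand indexed by the distance of the two classes survives. *)
rewrite (bigD1 d) //= mxE distE eqxx mulr1 big1 ?addr0 // => k kd.
rewrite mxE distE; case: eqP => [dk|_]; last by rewrite mulr0.
by case/eqP: kd; apply: val_inj; rewrite /= -dk.
Qed.
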